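(* Let $G_1$, $G_2$ and $G_k$ be generators over alphabets $\Sigma_1$, $\Sigma_2$ and $\Sigma_k$, respectively, where $\Sigma_1\cap\Sigma_2\subseteq\Sigma_k\subseteq\Sigma_1\cup\Sigma_2$. Let $K\subseteq L_m(G_1\parallel G_2\parallel G_k)$ be a language such that $K$ and $\overline{K}$ are conditionally decomposable with respect to $\Sigma_1,\Sigma_2,\Sigma_k$. For $i=1,2$, let $\mathrm{supCN}_{i+k}$ be the supremal controllable and normal sublanguage of $P_{i+k}(K)$ with respect to $L(G_i\parallel G_k)$, $\Sigma_{i+k,u}$ and $Q_{i+k}$, and let $\mathrm{supCN}'_k$ be the supremal controllable and normal sublanguage of $P_k(\mathrm{supCN}_{1+k})\cap P_k(\mathrm{supCN}_{2+k})$ with respect to $L(G_k)$, $\Sigma_{k,u}$ and $Q_k$. If, for $i=1,2$, the languages $\mathrm{supCN}_{i+k}$ and $\mathrm{supCN}'_k$ are synchronously nonconflicting (e.g., prefix-closed), then $\mathrm{supCN}'_k\parallel\mathrm{supCN}_{1+k}\parallel\mathrm{supCN}_{2+k}$ is a sublanguage of $K$ that is conditionally controllable for $G_1,G_2,G_k$ and conditionally normal for $G_1,G_2,G_k$ and $Q_{1+k},Q_{2+k}$.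
   Context: A generator is $G=(Q,\Sigma,f,q_0,Q_m)$ with finite state set $Q$, finite nonempty alphabet $\Sigma$, partial transition function $f:Q\times\Sigma\to Q$ (extended to words), initial state $q_0$ and marked states $Q_m\subseteq Q$; $L(G)=\{s\in\Sigma^*\mid f(q_0,s)\text{ is defined}\}$ and $L_m(G)=\{s\mid f(q_0,s)\in Q_m\}$. $\overline{L}$ denotes the prefix closure of $L$. A (natural) projection $\Sigma^*\to\Sigma_0^*$, $\Sigma_0\subseteq\Sigma$, erases the letters not in $\Sigma_0$. For $L_i\subseteq\Sigma_i^*$, $L_1\parallel L_2=P_1^{-1}(L_1)\cap P_2^{-1}(L_2)$, where $P_i:(\Sigma_1\cup\Sigma_2)^*\to\Sigma_i^*$ are the projections; for generators $\parallel$ is the synchronous product, satisfying $L(G_1\parallel G_2)=L(G_1)\parallel L(G_2)$ and $L_m(G_1\parallel G_2)=L_m(G_1)\parallel L_m(G_2)$. Languages $A,B$ are synchronously nonconflicting if $\overline{A\parallel B}=\overline{A}\parallel\overline{B}$. The global alphabet $\Sigma=\Sigma_1\cup\Sigma_2$ is partitioned into controllable events $\Sigma_c$ and uncontrollable events $\Sigma_u=\Sigma\setminus\Sigma_c$, and $\Sigma_o\subseteq\Sigma$ is the set of observable events. Put $\Sigma_{i+k}=\Sigma_i\cup\Sigma_k$, $\Sigma_{i+k,u}=\Sigma_{i+k}\cap\Sigma_u$, $\Sigma_{i+k,o}=\Sigma_{i+k}\cap\Sigma_o$, $\Sigma_{k,u}=\Sigma_k\cap\Sigma_u$, $\Sigma_{k,o}=\Sigma_k\cap\Sigma_o$.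 $P_{i+k}:\Sigma^*\to\Sigma_{i+k}^*$, $Q_{i+k}:\Sigma_{i+k}^*\to\Sigma_{i+k,o}^*$, $Q_k:\Sigma_k^*\to\Sigma_{k,o}^*$ are projections, and $P_k$ is the projection onto $\Sigma_k^*$. A language $M$ is controllable with respect to a prefix-closed language $L$ and a set of events $\Sigma_u'$ if $\overline{M}\Sigma_u'\cap L\subseteq\overline{M}$. It is normal with respect to $L$ and a projection $Q$ if $\overline{M}=Q^{-1}[Q(\overline{M})]\cap L$. The supremal controllable and normal sublanguage of $M$ with respect to $L,\Sigma_u',Q$ is the union of all sublanguages of $M$ that are controllable with respect to $L,\Sigma_u'$ and normal with respect to $L,Q$ (it is itself such a sublanguage). A language $M\subseteq\Sigma^*$ is conditionally decomposable with respect to $\Sigma_1,\Sigma_2,\Sigma_k$ if $M=P_{1+k}(M)\parallel P_{2+k}(M)$. A language $M\subseteq L_m(G_1\parallel G_2\parallel G_k)$ is conditionally controllable for $G_1,G_2,G_k$ if, for $i=1,2$, $P_{i+k}(M)$ is controllable with respect to $L(G_i\parallel G_k)$ and $\Sigma_{i+k,u}$; it is conditionally normal for $G_1,G_2,G_k$ and $Q_{1+k},Q_{2+k}$ if, for $i=1,2$, $P_{i+k}(M)$ is normal with respect to $L(G_i\parallel G_k)$ and $Q_{i+k}$. *)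

(* Defs.v *)
From HB Require Import structures.
From mathcomp Require Import all_boot.
From mathcomp Require Import classical_sets.

Set Implicit Arguments.
Unset Strict Implicit.
Unset Printing Implicit Defensive.

Local Open Scope set_scope.
Local Open Scope classical_set_scope.

(** All alphabets are subsets of one finite type [E] of events; a language
    over an alphabet [A] is a [set (seq E)] included in [words A].  Operations
    that depend on the alphabets (inverse projections, parallel composition)
    take them as explicit arguments. *)

Section Languages.
Variable E : finType.
Implicit Types (A B D O Eu : {set E}) (L M N : set (seq E)).

Definition words A : set (seq E) := [set s | all [in A] s].

Definition prefix_closure L : set (seq E) :=
  [set s | exists2 t, L t & prefix s t].

(** The projection onto [words A].  Its domain [words D] is recorded only in
    the inverse projection, where it matters. *)
Definition proj A (s : seq E) : seq E := [seq e <- s | e \in A].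

Definition proj_inv D A L : set (seq E) := words D `&` proj A @^-1` L.

Definition sync A B L1 L2 : set (seq E) :=
  proj_inv (A :|: B) A L1 `&` proj_inv (A :|: B) B L2.

Definition sync_nonconflicting A B L1 L2 : Prop :=
  prefix_closure (sync A B L1 L2)
  = sync A B (prefix_closure L1) (prefix_closure L2).

Lemma sync_nonconflicting_closed A B L1 L2 :
  prefix_closure L1 = L1 -> prefix_closure L2 = L2 ->
  sync_nonconflicting A B L1 L2.
Proof.
move=> c1 c2; rewrite /sync_nonconflicting c1 c2; apply/seteqP.
split=> s; last first.
  by move=> h; exists s; rewrite ?prefix_refl.
move=> [t + /prefixP[u tE]]; rewrite {}tE => -[[w h1] [_ h2]].
have ws : words (A :|: B) s by move: w; rewrite /words /= all_cat => /andP[].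
split; split=> //; rewrite /preimage /=.
  by rewrite -c1; exists (proj A (s ++ u)) => //;
     rewrite /proj filter_cat prefix_prefix.
by rewrite -c2; exists (proj B (s ++ u)) => //;
   rewrite /proj filter_cat prefix_prefix.
Qed.

Definition controllable L Eu M : Prop :=
  [set rcons s e | s in prefix_closure M & e in [set` Eu]] `&` L
  `<=` prefix_closure M.

(** Normality with respect to [L] and the projection from [words D] onto
    [words O]. *)
Definition normal L D O M : Prop :=
  prefix_closure M
  = proj_inv D O (proj O @` prefix_closure M) `&` L.

Definition supCN L Eu D O M : set (seq E) :=
  \bigcup_(N in [set N | [/\ N `<=` M, controllable L Eu N & normal L D O N]])
    N.

Definition cond_decomposable A1 A2 Ak M : Prop :=
  M = sync (A1 :|: Ak) (A2 :|: Ak)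
        (proj (A1 :|: Ak) @` M) (proj (A2 :|: Ak) @` M).

End Languages.

(** The partial transition function on [state * A] is encoded as an
    option-valued function on [state * E] that is undefined outside [A]. *)
Record generator (E : finType) (A : {set E}) := Generator {
  state : finType;
  trans : state -> E -> option state;
  init : state;
  marked : {set state};
  alphabet_neq0 : A != finset.set0;
  trans_alphabet : forall q e, e \notin A -> trans q e = None
}.

Arguments trans {E A} g q e.
Arguments init {E A} g.
Arguments marked {E A} g.

Section Generators.
Variables (E : finType).

Fixpoint run (A : {set E}) (G : generator A) (q : state G) (s : seq E) :
    option (state G) :=
  if s is e :: s' then obind (fun q' => run q' s') (trans G q e) else Some q.

Definition gen_lang (A : {set E}) (G : generator A) : set (seq E) :=
  [set s | exists q, run (init G) s = Some q].

Definition marked_lang (A : {set E}) (G : generator A) : set (seq E) :=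
  [set s | exists2 q, run (init G) s = Some q & q \in marked G].

Section SyncProduct.
Variables (A B : {set E}) (G : generator A) (H : generator B).

Definition sync_trans (q : state G * state H) (e : E) :
    option (state G * state H) :=
  match e \in A, e \in B with
  | true, true =>
      obind (fun x => omap (pair x) (trans H q.2 e)) (trans G q.1 e)
  | true, false => omap (pair^~ q.2) (trans G q.1 e)
  | false, true => omap (pair q.1) (trans H q.2 e)
  | false, false => None
  end.

Lemma sync_alphabet_neq0 : A :|: B != finset.set0.
Proof. by rewrite finset.setU_eq0 negb_and (alphabet_neq0 G). Qed.

Lemma sync_trans_alphabet q e : e \notin A :|: B -> sync_trans q e = None.
Proof.
by rewrite finset.in_setU negb_or /sync_trans => /andP[/negbTE-> /negbTE->].
Qed.

Definition sync_gen : generator (A :|: B) :=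
  @Generator E (A :|: B) (state G * state H)%type sync_trans
    (init G, init H) (finset.setX (marked G) (marked H))
    sync_alphabet_neq0 sync_trans_alphabet.

Lemma run_sync s (q : state G) (r : state H) x y :
  run ((q, r) : state sync_gen) s = Some (x, y) <->
  [/\ words (A :|: B) s, run q (proj A s) = Some x
    & run r (proj B s) = Some y].
Proof.
elim: s q r => [|e s IH] q r; rewrite /words /=.
  by split=> [[-> ->]|[_ [->] [->]]].
rewrite /sync_trans /= finset.in_setU.
case: (e \in A); case: (e \in B) => /=.
- case: (trans G q e) => [q'|] /=; last by split=> // -[].
  case: (trans H r e) => [r'|] /=; last by split=> // -[].
  exact: IH.
- case: (trans G q e) => [q'|] /=; last by split=> // -[].
  exact: IH.
- case: (trans H r e) => [r'|] /=; last by split=> // -[].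
  exact: IH.
- by split=> // -[].
Qed.

Lemma gen_lang_sync :
  gen_lang sync_gen = sync A B (gen_lang G) (gen_lang H).
Proof.
apply/seteqP; split=> s.
  case=> -[x y] /run_sync[w h1 h2].
  by split; split=> //; [exists x|exists y].
by case=> -[w [x h1]] [_ [y h2]]; exists (x, y); apply/run_sync.
Qed.

Lemma marked_lang_sync :
  marked_lang sync_gen = sync A B (marked_lang G) (marked_lang H).
Proof.
apply/seteqP; split=> s.
  case=> -[x y] /run_sync[w h1 h2]; rewrite finset.in_setX => /andP[m1 m2].
  by split; split=> //; [exists x|exists y].
case=> -[w [x h1 m1]] [_ [y h2 m2]].
by exists (x, y); [apply/run_sync|rewrite finset.in_setX m1].
Qed.

End SyncProduct.
End Generators.

Notation "G ∥ H" := (sync_gen G H) (at level 50, left associativity).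

Section Conditional.
Variables (E : finType) (A1 A2 Ak : {set E}).
Variables (G1 : generator A1) (G2 : generator A2) (Gk : generator Ak).
Implicit Types (Su So : {set E}) (M : set (seq E)).

Definition cond_controllable Su M : Prop :=
  [/\ M `<=` marked_lang (G1 ∥ G2 ∥ Gk),
      controllable (gen_lang (G1 ∥ Gk)) ((A1 :|: Ak) :&: Su)
        (proj (A1 :|: Ak) @` M)
    & controllable (gen_lang (G2 ∥ Gk)) ((A2 :|: Ak) :&: Su)
        (proj (A2 :|: Ak) @` M)].

Definition cond_normal So M : Prop :=
  [/\ M `<=` marked_lang (G1 ∥ G2 ∥ Gk),
      normal (gen_lang (G1 ∥ Gk)) (A1 :|: Ak) ((A1 :|: Ak) :&: So)
        (proj (A1 :|: Ak) @` M)
    & normal (gen_lang (G2 ∥ Gk)) (A2 :|: Ak) ((A2 :|: Ak) :&: So)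
        (proj (A2 :|: Ak) @` M)].

End Conditional.

(* Main.v *)
(** The supremal sublanguages are themselves controllable and normal, and both
    properties survive synchronization with a language over the coordinator
    alphabet, because nonconflictingness lets prefix closure commute with the
    synchronous product.  Since [supCNk'] lies in the projections of both
    [supCN1k] and [supCN2k], any word of [supCN1k ∥ supCNk'] can be merged with
    a word of [supCN2k], so the projection of the triple product to [S1 :|: Sk]
    is exactly [supCN1k ∥ supCNk'], and symmetrically for [S2 :|: Sk]. *)
Require Import Defs.
From mathcomp Require Import all_boot.
From mathcomp Require Import classical_sets.

Local Open Scope set_scope.
Local Open Scope classical_set_scope.

Section LanguageLemmas.
Variable E : finType.
Implicit Types (A B C D O Eu : {set E}) (L M N : set (seq E)) (s u v : seq E).

Lemma sub_prefix_closure L : L `<=` prefix_closure L.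
Proof. by move=> s Ls; exists s; rewrite ?prefix_refl. Qed.

Lemma prefix_closureS L N : L `<=` N -> prefix_closure L `<=` prefix_closure N.
Proof. by move=> LN s [t /LN Nt st]; exists t. Qed.

Lemma words_sub A B s : A \subset B -> words A s -> words B s.
Proof. by move=> /fintype.subsetP AB; apply: sub_all => e /AB. Qed.

Lemma proj_id A s : words A s -> proj A s = s.
Proof. by move=> /all_filterP. Qed.

Lemma words_proj A s : words A (proj A s).
Proof. exact: filter_all. Qed.

Lemma proj_proj A B s : A \subset B -> proj A (proj B s) = proj A s.
Proof.
move=> /fintype.subsetP AB; rewrite /proj -filter_predI.
by apply: eq_filter => e /=; case: (boolP (e \in A)) => // /AB ->.
Qed.

Lemma proj_rcons A s e :
  proj A (rcons s e) = if e \in A then rcons (proj A s) e else proj A s.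
Proof. exact: filter_rcons. Qed.

Lemma syncC A B L1 L2 : sync A B L1 L2 = sync B A L2 L1.
Proof. by rewrite /sync finset.setUC setIC. Qed.

(** Shuffle by a nested induction on [u] and [v]: a head private to one alphabet is emitted alone,
    and two shared heads must coincide by the equality of projections, so they are emitted
    together. *)
Lemma merge_words A B u v :
  words A u -> words B v -> proj (A :&: B) u = proj (A :&: B) v ->
  exists w, [/\ words (A :|: B) w, proj A w = u & proj B w = v].
Proof.
(* For the base cases: once one word is exhausted, the other has no shared letter left and projects
   to nothing on that side. *)
have disjoint_proj X Y s : words X s -> proj (X :&: Y) s = [::] ->
    proj Y s = [::].
  move=> Xs; rewrite -{2}(proj_id _ _ Xs) /proj -filter_predI => sXY.
  by rewrite -[RHS]sXY; apply: eq_filter => e; rewrite /= inE andbC.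
elim: u v => [|e u IHu] v.
  move=> _ Bv /esym vAB; exists v; split.
  - by apply: words_sub Bv; rewrite finset.subsetUr.
  - by apply: (disjoint_proj B) => //; rewrite finset.setIC.
  - exact: proj_id.
elim: v => [Au _ uAB|f v IHv Aeu Bfv].
  exists (e :: u); split.
  - by apply: words_sub Au; rewrite finset.subsetUl.
  - exact: proj_id.
  - exact: (disjoint_proj A).
have /= /andP[Ae Au] := Aeu; have /= /andP[Bf Bv] := Bfv.
rewrite /= !finset.in_setI Ae Bf andbT /=.
have [Be|nBe] := boolP (e \in B); last first.
  move=> uAB; have [|w [ABw wA wB]] := IHu (f :: v) Au Bfv.
    by rewrite uAB /= finset.in_setI Bf andbT.
  exists (e :: w); split.
  - by rewrite /words /= finset.in_setU Ae.
  - by rewrite /= Ae wA.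
  - by rewrite /= (negbTE nBe).
have [Af [<- uAB]|nAf uAB] := boolP (f \in A).
  have [w [ABw wA wB]] := IHu v Au Bv uAB.
  exists (e :: w); split.
  - by rewrite /words /= finset.in_setU Ae.
  - by rewrite /= Ae wA.
  - by rewrite /= Be wB.
have [|w [ABw wA wB]] := IHv Aeu Bv.
  by rewrite /= finset.in_setI Ae Be.
exists (f :: w); split.
- by rewrite /words /= finset.in_setU Bf orbT.
- by rewrite /= (negbTE nAf).
- by rewrite /= Bf wB.
Qed.

Lemma supCN_sub L Eu D O M : supCN L Eu D O M `<=` M.
Proof. by move=> s [N [NM _ _]] /NM. Qed.

(** Prefix closure commutes with unions, so closure properties of [supCN] can be checked inside a
    single member [N]. *)
Lemma prefix_closure_supCN L Eu D O M s :
  prefix_closure (supCN L Eu D O M) s ->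
  exists N, [/\ N `<=` supCN L Eu D O M, controllable L Eu N,
    normal L D O N & prefix_closure N s].
Proof.
move=> [t [N cnN Nt] st]; have [_ cN nN] := cnN.
by exists N; split=> //; [move=> u Nu; exists N | exists t].
Qed.

Lemma supCN_controllable L Eu D O M : controllable L Eu (supCN L Eu D O M).
Proof.
move=> _ [[s /prefix_closure_supCN[N [NS cN _ Ns]] [e Eue <-]] Lse].
by apply: (prefix_closureS _ _ NS); apply: cN; split=> //; exists s => //; exists e.
Qed.

Lemma supCN_normal L Eu D O M : normal L D O (supCN L Eu D O M).
Proof.
apply/seteqP; split=> s.
  move=> /prefix_closure_supCN[N [NS _ nN]]; rewrite {1}nN.
  move=> [[Ds [t Nt ts]] Ls]; split=> //; split=> //.
  by exists t => //; apply: (prefix_closureS _ _ NS).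
move=> [[Ds [t /prefix_closure_supCN[N [NS _ nN Nt]] ts]] Ls].
apply: (prefix_closureS _ _ NS); rewrite nN.
by split=> //; split=> //; exists t.
Qed.

Lemma normal_sub_words L D O N : normal L D O N -> N `<=` words D.
Proof. by move=> nN s /sub_prefix_closure; rewrite nN => -[[]]. Qed.

Lemma sync_subE A C L Lk :
  C \subset A ->
  sync A C L Lk = [set s | [/\ words A s, L s & Lk (proj C s)]].
Proof.
move=> CA; rewrite /sync (finset.setUidPl CA); apply/seteqP; split=> s.
  by move=> [[As]]; rewrite /preimage /= proj_id // => Ls [_ Lks].
by move=> [As Ls Lks]; split; split=> //; rewrite /preimage /= proj_id.
Qed.

(** An uncontrollable event outside [C] leaves the projection to [C] unchanged; one inside [C] is
    also uncontrollable for [Nk], and [LLk] places the extended projection in [Lk]. *)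
Lemma sync_controllable A C L Lk Eu N Nk :
  C \subset A -> (forall s, L s -> Lk (proj C s)) ->
  sync_nonconflicting A C N Nk ->
  controllable L (A :&: Eu) N -> controllable Lk (C :&: Eu) Nk ->
  controllable L (A :&: Eu) (sync A C N Nk).
Proof.
move=> CA LLk nc cN cNk; rewrite /controllable nc !sync_subE //.
move=> _ [[s [As Ns Nks] [e AEue <-]] Lse].
have /andP[Ae Eue] : (e \in A) && (e \in Eu) by rewrite -finset.in_setI.
split.
- by rewrite /words /= all_rcons Ae.
- by apply: cN; split=> //; exists s => //; exists e.
have := LLk _ Lse; rewrite proj_rcons; case: ifP => // Ce Lkse.
apply: cNk; split=> //; exists (proj C s) => //; exists e => //.
by rewrite /= finset.in_setI Ce.
Qed.

Lemma sync_normal A C L Lk O N Nk :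
  C \subset A -> (forall s, L s -> Lk (proj C s)) ->
  sync_nonconflicting A C N Nk ->
  normal L A (A :&: O) N -> normal Lk C (C :&: O) Nk ->
  normal L A (A :&: O) (sync A C N Nk).
Proof.
move=> CA LLk nc nN nNk; rewrite /normal nc sync_subE //.
apply/seteqP; split=> s.
  move=> [As Ns Nks]; split; first by split=> //; exists s.
  by move: Ns; rewrite nN => -[].
move=> [[As [t [At Nt Nkt] ts]] Ls]; split=> //.
  by rewrite nN; split=> //; split=> //; exists t.
rewrite nNk; split; last exact: LLk.
split; first exact: words_proj.
(* Since [C :&: O] lies in [A :&: O], words that look alike over [A] have look-alike projections to
   [C], so the witness for [N] projects to one for [Nk]. *)
exists (proj C t) => //.
have projCO u : proj (C :&: O) (proj C u) = proj (C :&: O) (proj (A :&: O) u).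
  by rewrite !proj_proj ?finset.subsetIl ?finset.setSI.
by rewrite /preimage /= !projCO ts.
Qed.

Lemma proj_sync3 A B C L1 L2 Lk :
  A :&: B = C -> L2 `<=` words B -> Lk `<=` proj C @` L2 ->
  proj A @` [set s | [/\ words (A :|: B) s, L1 (proj A s), L2 (proj B s)
                        & Lk (proj C s)]]
  = sync A C L1 Lk.
Proof.
move=> ABC L2B LkL2.
have CA : C \subset A by rewrite -ABC finset.subsetIl.
rewrite sync_subE //; apply/seteqP; split=> s.
  move=> [t [ABt L1t _ Lkt] <-].
  by split=> //; [exact: words_proj | rewrite proj_proj].
(* [v] is a word of [L2] that agrees with [s] on the shared alphabet [C], so merging the two gives a
   preimage of [s]. *)
move=> [As L1s Lks]; have [v L2v vs] := LkL2 _ Lks.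
have [|w [ABw wA wB]] := merge_words A B s v As (L2B _ L2v).
  by rewrite ABC.
exists w => //; split; rewrite ?wA ?wB //.
by rewrite -(proj_proj _ _ _ CA) wA.
Qed.

(** Flattens the nested product into a form symmetric in the two components, so that [proj_sync3]
    applies to either side. *)
Lemma sync3E A B C L1 L2 Lk :
  C \subset A ->
  sync (C :|: A) B (sync C A Lk L1) L2
  = [set s | [/\ words (A :|: B) s, L1 (proj A s), L2 (proj B s)
                & Lk (proj C s)]].
Proof.
move=> CA; rewrite (syncC C) (finset.setUidPr CA) (sync_subE A C) //.
apply/seteqP; split=> s.
  by move=> [[ABs [_ L1s]]]; rewrite /= proj_proj // => Lks [_ L2s].
move=> [ABs L1s L2s Lks]; split; split=> //.
by split; rewrite /= ?proj_proj //; exact: words_proj.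
Qed.

End LanguageLemmas.

Theorem theorem16 (E : finType) (S1 S2 Sk Sc So : {set E})
    (G1 : generator S1) (G2 : generator S2) (Gk : generator Sk)
    (K : set (seq E)) :
  S1 :&: S2 \subset Sk -> Sk \subset S1 :|: S2 ->
  Sc \subset S1 :|: S2 -> So \subset S1 :|: S2 ->
  K `<=` marked_lang (G1 ∥ G2 ∥ Gk) ->
  cond_decomposable S1 S2 Sk K ->
  cond_decomposable S1 S2 Sk (prefix_closure K) ->
  let Su := (S1 :|: S2) :\: Sc in
  let S1k := S1 :|: Sk in
  let S2k := S2 :|: Sk in
  let supCN1k :=
    supCN (gen_lang (G1 ∥ Gk)) (S1k :&: Su) S1k (S1k :&: So) (proj S1k @` K) in
  let supCN2k :=
    supCN (gen_lang (G2 ∥ Gk)) (S2k :&: Su) S2k (S2k :&: So) (proj S2k @` K) in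
  let supCNk' :=
    supCN (gen_lang Gk) (Sk :&: Su) Sk (Sk :&: So)
      (proj Sk @` supCN1k `&` proj Sk @` supCN2k) in
  sync_nonconflicting S1k Sk supCN1k supCNk' ->
  sync_nonconflicting S2k Sk supCN2k supCNk' ->
  let M := sync (Sk :|: S1k) S2k (sync Sk S1k supCNk' supCN1k) supCN2k in
  [/\ M `<=` K,
      cond_controllable G1 G2 Gk Su M
    & cond_normal G1 G2 Gk So M].
Proof.
move=> S12k Sk12 _ _ KG dK _ Su S1k S2k N1 N2 Nk nc1 nc2 M.
have Sk1 : Sk \subset S1k by rewrite finset.subsetUr.
have Sk2 : Sk \subset S2k by rewrite finset.subsetUr.
(* By distributivity the intersection is [(S1 :&: S2) :|: Sk], and [S12k] absorbs the first part. *)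
have S12kE : S1k :&: S2k = Sk by rewrite -finset.setUIl (finset.setUidPr S12k).
have ME : M = [set s | [/\ words (S1k :|: S2k) s, N1 (proj S1k s),
    N2 (proj S2k s) & Nk (proj Sk s)]] by exact: sync3E.
have MK : M `<=` K.
  (* Both projections of [s] lie in those of [K], and decomposability of [K] reassembles them. *)
  rewrite ME dK => s [ws /supCN_sub K1s /supCN_sub K2s _].
  by split; split.
have MG : M `<=` marked_lang (G1 ∥ G2 ∥ Gk) by apply: subset_trans KG.
have N1w : N1 `<=` words S1k by apply: normal_sub_words; exact: supCN_normal.
have N2w : N2 `<=` words S2k by apply: normal_sub_words; exact: supCN_normal.
have M1 : proj S1k @` M = sync S1k Sk N1 Nk.
  by rewrite ME; apply: proj_sync3 => // s /supCN_sub[].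
have M2 : proj S2k @` M = sync S2k Sk N2 Nk.
  (* The same lemma with the components exchanged: now [N1] is the one absorbed by [Nk], and only
     the order of unions and conjuncts differs. *)
  rewrite ME -(@proj_sync3 _ S2k S1k _ _ N1) //; last first.
  - by move=> s /supCN_sub[].
  - by rewrite finset.setIC.
  by congr image; apply/seteqP; split=> s /= []; rewrite finset.setUC.
have LGk A (G : generator A) s : gen_lang (G ∥ Gk) s -> gen_lang Gk (proj Sk s).
  by rewrite gen_lang_sync => -[_ [_]].
split=> //; split=> //; rewrite ?M1 ?M2.
- apply: sync_controllable (LGk _ _) _ _ _ => //; exact: supCN_controllable.
- apply: sync_controllable (LGk _ _) _ _ _ => //; exact: supCN_controllable.
- apply: sync_normal (LGk _ _) _ _ _ => //; exact: supCN_normal.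
- apply: sync_normal (LGk _ _) _ _ _ => //; exact: supCN_normal.
Qed.
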